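(* Let $V_0$ be a finite dimensional real euclidean vector space with a basis $\Delta_0$, let $P\subsetneq R\subset\Delta_0$, and let $\Lambda\in V_0$. Let $\widehat b_{P,R}^\Lambda$ be the number of $\lambda\in\Delta_P^R$ such that $\lambda(\Lambda)\le0$. Then, as functions on $V_0$, $$\sum_{\mathfrak p\in\mathcal P(\Delta_P^R)}(-1)^{\alpha^\Lambda_{\mathfrak p}}\,\phi_{\mathfrak p}^\Lambda=(-1)^{\widehat b^\Lambda_{P,R}}\,\widehat\theta_{P,R}^\Lambda,$$ where $\mathcal P(\Delta_P^R)$ is the set of ordered partitions of $\Delta_P^R$.
   Context: Vectors of $V_0$ are regarded as linear forms via $\lambda(H)=\langle\lambda,H\rangle$. The basis $\Delta_0$ is not assumed obtuse. $\Delta_P^R$ is the set of orthogonal projections of the elements of $R\setminus P$ on the orthogonal complement of the span of $P$; it is a basis of its span $V_P^R$; $\widehat\Delta_P^R\subset V_P^R$ is the dual basis and $D=D_P^R:\Delta_P^R\to\widehat\Delta_P^R$ the canonical bijection ($\langle D(\lambda),\lambda'\rangle=\delta_{\lambda,\lambda'}$). $\widehat\theta_{P,R}^\Lambda$ is the characteristic function of the set of $H\in V_0$ such that for every $\lambda\in\Delta_P^R$, with $\mu=D(\lambda)$: $\mu(H)\le0$ if $\lambda(\Lambda)>0$, and $\mu(H)>0$ otherwise. Write $\Delta=\Delta_P^R$, $\widehat\Delta=\widehat\Delta_P^R$, $V=V_P^R$. An ordered partition $\mathfrak p$ of $\Delta$ is a sequence $(F^1_{\mathfrak p},\dots,F^r_{\mathfrak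 p})$, $r=r(\mathfrak p)\ge1$, of nonempty pairwise disjoint subsets with union $\Delta$; $a^u_{\mathfrak p}$ is the cardinality of $F^u_{\mathfrak p}$. Put $E^v_{\mathfrak p}=\bigcup_{u\le v}F^u_{\mathfrak p}$, let $U^v_{\mathfrak p}$ be the span of $D(E^v_{\mathfrak p})$ and let $W^u_{\mathfrak p}$ be the orthogonal complement of $U^{u-1}_{\mathfrak p}$ in $U^u_{\mathfrak p}$ (equivalently, the orthogonal complement of the span of $\Delta\setminus E^u_{\mathfrak p}$ in the span of $\Delta\setminus E^{u-1}_{\mathfrak p}$), so $V=\bigoplus_{u=1}^rW^u_{\mathfrak p}$ orthogonally. For $\lambda\in F^u_{\mathfrak p}$ and $\mu=D(\lambda)$, let $\lambda_{\mathfrak p}$ and $\mu_{\mathfrak p}$ be the orthogonal projections of $\lambda$ and $\mu$ on $W^u_{\mathfrak p}$. $\phi^\Lambda_{\mathfrak p}$ is the characteristic function of the set of $H$ such that for all $\lambda\in\Delta$, with $\mu=D(\lambda)$: $\lambda_{\mathfrak p}(H)\le0$ if $\mu_{\mathfrak p}(\Lambda)>0$, and $\lambda_{\mathfrak p}(H)>0$ otherwise. $b^\Lambda_{\mathfrak p}$ is the number of $\mu\in\widehat\Delta$ with $\mu_{\mathfrak p}(\Lambda)\le0$, and $\alpha^\Lambda_{\mathfrak p}=b^\Lambda_{\mathfrak p}+\sum_{u=1}^{r}(a^u_{\mathfrak p}+1)$. *)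

(* Defs.v *)
From HB Require Import structures.
From mathcomp Require Import all_boot all_order all_algebra.
From mathcomp Require Import reals.
From mathcomp Require classical_sets.

Set Implicit Arguments.
Unset Strict Implicit.
Unset Printing Implicit Defensive.

Import Order.TTheory GRing.Theory Num.Theory.
Local Open Scope ring_scope.

(* A euclidean space is a [V : vectType K] with a form [dot : {dot V for idfun}]
   (bilinear, symmetric and positive definite); the value of the linear form
   attached to [v] at [H] is [dot v H].

   Finite sets of vectors are handled as families [lam : I -> V] restricted to
   an index set [A : {set I}]; subsets and ordered partitions are taken on the
   side of the indices.  The families that are used are linearly independent,
   hence injective (see [projfam_notin] below). *)

Section Euclidean.
Variables (K : realType) (V : vectType K) (dot : {dot V for idfun}).

Definition orthoproj (U : {vspace V}) : 'End(V) := daddv_pi U (orthov dot U).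

Section Families.
Variable I : finType.

Definition famspan (lam : I -> V) (A : {set I}) : {vspace V} :=
  <<[seq lam i | i in A]>>%VS.

(* [projfam e P] indexes Delta_P^R by the elements of [R :\: P]. *)
Definition projfam (e : I -> V) (P : {set I}) (i : I) : V :=
  orthoproj (orthov dot (famspan e P)) (e i).

(* The vector D(lam i); it is characterized by [dual_mem] and [dual_dot]. *)
Definition dual (lam : I -> V) (A : {set I}) (i : I) : V :=
  classical_sets.xget 0 (fun mu : V => mu \in famspan lam A /\
    {in A, forall j, dot mu (lam j) = (i == j)%:R}).

Definition theta_hat (lam : I -> V) (A : {set I}) (Lam H : V) : bool :=
  [forall i in A, if 0 < dot (lam i) Lam then dot (dual lam A i) H <= 0
                  else 0 < dot (dual lam A i) H].

Definition b_hat (lam : I -> V) (A : {set I}) (Lam : V) : nat :=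
  #|[set i in A | dot (lam i) Lam <= 0]|.

Definition ordered_partition (A : {set I}) (p : seq {set I}) : bool :=
  [&& (0 < size p)%N,
      set0 \notin p,
      pairwise (fun F F' : {set I} => [disjoint F & F']) p &
      \bigcup_(F <- p) F == A].

Section OrderedPartition.
Variables (lam : I -> V) (A : {set I}) (p : seq {set I}).

Definition blocks_upto (v : nat) : {set I} := \bigcup_(F <- take v p) F.

Definition Uspace (v : nat) : {vspace V} :=
  famspan (dual lam A) (blocks_upto v).

Definition Wspace (u : nat) : {vspace V} :=
  (Uspace u :&: orthov dot (Uspace u.-1))%VS.

(* The u such that [i] is in F^u; u is counted from 1. *)
Definition block_of (i : I) : nat := (find (fun F : {set I} => i \in F) p).+1.

Definition lam_part (i : I) : V := orthoproj (Wspace (block_of i)) (lam i).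

Definition mu_part (i : I) : V :=
  orthoproj (Wspace (block_of i)) (dual lam A i).

Definition phi (Lam H : V) : bool :=
  [forall i in A, if 0 < dot (mu_part i) Lam then dot (lam_part i) H <= 0
                  else 0 < dot (lam_part i) H].

Definition b_part (Lam : V) : nat := #|[set i in A | dot (mu_part i) Lam <= 0]|.

Definition alpha (Lam : V) : nat := (b_part Lam + \sum_(F <- p) (#|F| + 1))%N.

End OrderedPartition.
End Families.

Implicit Types (U : {vspace V}) (u v : V).

Lemma dot_sym u v : dot u v = dot v u.
Proof. by rewrite hermC expr0 mul1r. Qed.

Lemma dot_eq0 u : (dot u u == 0) = (u == 0).
Proof.
have [->|u0] := eqVneq u 0; first by rewrite linear0l eqxx.
by rewrite gt_eqF // neq0_dnorm_gt0.
Qed.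

Lemma orthov_cap U : (U :&: orthov dot U)%VS = 0%VS.
Proof.
apply/eqP; rewrite -subv0; apply/subvP => v /memv_capP[vU /mem_orthovP vO].
by rewrite memv0 -dot_eq0 vO.
Qed.

Lemma orthov_add U : (U + orthov dot U)%VS = fullv.
Proof.
pose b := vbasis U.
pose g v := \sum_(k < \dim U) dot v b`_k *: b`_k.
have glin : linear g.
  move=> a u v; rewrite /g scaler_sumr -big_split; apply: eq_bigr => k _ /=.
  by rewrite linearPl scalerDl scalerA.
pose gL := GRing.isLinear.Build _ _ _ _ g glin.
pose G : {linear V -> V} := HB.pack g gL.
have Gin v : linfun G v \in U.
  rewrite lfunE /= /g; apply: memv_suml => k _; apply/memvZ/vbasis_mem/mem_nth.
  by rewrite size_tuple.
have kG : (lker (linfun G) <= orthov dot U)%VS.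
  apply/subvP => v; rewrite memv_ker lfunE /= /g => /eqP gv0.
  apply/mem_orthovP => u uU; rewrite (coord_vbasis uU) linear_sumr big1 // => k _.
  rewrite linearZr_LR /=; suff -> : dot v b`_k = 0 by rewrite mulr0.
  exact: (freeP (basis_free (vbasisP U)) (fun k : 'I_(\dim U) => dot v b`_k) gv0 k).
have := dimv_sum_cap U (orthov dot U); rewrite orthov_cap dimv0 addn0 => dimUO.
apply/eqP; rewrite eqEdim subvf dimUO -(limg_ker_dim (linfun G) fullv) capfv addnC.
apply: leq_add; last exact: dimvS.
apply: dimvS.
by apply/subvP => _ /memv_imgP[v _ ->].
Qed.

Lemma orthoproj_mem U v : orthoproj U v \in U.
Proof. exact: memv_pi. Qed.

Lemma orthoproj_orth U v : {in U, forall u, dot (v - orthoproj U v) u = 0}.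
Proof.
suff /mem_orthovP: v - orthoproj U v \in orthov dot U by [].
have := daddv_pi_add (w := v) (orthov_cap U); rewrite orthov_add memvf.
move=> /(_ isT) {1}<-; rewrite addrAC subrr add0r; exact: memv_pi.
Qed.

Section FamilyFacts.
Variable I : finType.
Implicit Types (lam e : I -> V) (A B P R : {set I}).

Lemma mem_famspan lam A i : i \in A -> lam i \in famspan lam A.
Proof. by move=> iA; apply/memv_span/image_f. Qed.

Lemma famspan_sub lam A (U : {vspace V}) :
  {in A, forall i, lam i \in U} -> (famspan lam A <= U)%VS.
Proof. by move=> h; apply/span_subvP => _ /imageP[i iA ->]; apply: h. Qed.

Lemma famspanS lam A B : A \subset B -> (famspan lam A <= famspan lam B)%VS.
Proof. by move/subsetP=> AB; apply: famspan_sub => i /AB; apply: mem_famspan. Qed.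

Lemma projfam_diff e P i : e i - projfam e P i \in famspan e P.
Proof.
set U := famspan e P; rewrite /projfam -/U.
have [u uU [w wO]] : exists2 u, u \in U & exists2 w, w \in orthov dot U & e i = u + w.
  have: e i \in (U + orthov dot U)%VS by rewrite orthov_add memvf.
  by case/memv_addP => u uU [w wO ->]; exists u => //; exists w.
move=> ->; set p := orthoproj _ _.
suff -> : p = w by rewrite addrK.
have pO : p \in orthov dot U by apply: orthoproj_mem.
have dO : p - w \in orthov dot U by rewrite memvB.
apply/eqP; rewrite -subr_eq0 -dot_eq0.
have {1}-> : p - w = u - (u + w - p) by rewrite !opprD opprK !addrA subrr add0r addrC.
move/mem_orthovP: (dO) => /(_ u uU) dO0.
by rewrite linearBl /= dot_sym dO0 sub0r oppr_eq0 orthoproj_orth.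
Qed.

(* Linear independence of the projected family: Delta_P^R is a basis of its
   span, and its elements are indexed without repetition. *)
Lemma projfam_notin e P R :
    (forall i, e i \notin famspan e [set~ i]) ->
  {in R :\: P, forall i,
    projfam e P i \notin famspan (projfam e P) ((R :\: P) :\ i)}.
Proof.
move=> efree i; rewrite inE => /andP[iP _]; apply/negP => h.
case/negP: (efree i); rewrite -[e i](subrK (projfam e P i)).
have sub j : j != i -> e j \in famspan e [set~ i].
  by move=> ji; apply: mem_famspan; rewrite !inE.
have subP : (famspan e P <= famspan e [set~ i])%VS.
  apply: famspan_sub => j jP; apply: sub; apply: contraNneq iP => <-.
  exact: jP.
apply: memvD; first exact: subvP subP _ (projfam_diff _ _ _).
apply: subvP h; apply: famspan_sub => j; rewrite !inE => /and3P[ji _ _].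
rewrite -[projfam e P j](subKr (e j)); apply: memvB; first exact: sub.
exact: subvP subP _ (projfam_diff _ _ _).
Qed.

Lemma basis_notin n (Delta0 : n.-tuple V) (i : 'I_n) :
  free Delta0 -> tnth Delta0 i \notin famspan (tnth Delta0) [set~ i].
Proof.
move=> /freeP fr; apply/negP => h.
have [c /= hc] : exists c : 'I_n -> K,
    tnth Delta0 i = \sum_(j in [set~ i]) c j *: tnth Delta0 j.
  move: h; rewrite /famspan span_def big_image /= => /memv_sumP[v vv ->].
  exists (fun j => classical_sets.xget 0 (fun k => v j = k *: tnth Delta0 j)).
  apply: eq_bigr => j jA; case: classical_sets.xgetP => [k _ //|nok].
  by have /vlineP[k vk] := vv j jA; case: (nok k).
pose k j := if j == i then -1 else c j.
have: k i = 0.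
  apply: fr; rewrite (bigD1 i) //= -!tnth_nth /k eqxx scaleN1r hc addrC.
  apply/eqP; rewrite subr_eq0; apply/eqP; apply: eq_big => j; first by rewrite !inE.
  by move=> ji; rewrite (negbTE ji) -tnth_nth.
by move/eqP; rewrite /k eqxx oppr_eq0 oner_eq0.
Qed.

Section Dual.
Variables (lam : I -> V) (A : {set I}).
Hypothesis lam_notin : {in A, forall i, lam i \notin famspan lam (A :\ i)}.

Lemma dual_spec i : i \in A -> dual lam A i \in famspan lam A /\
  {in A, forall j, dot (dual lam A i) (lam j) = (i == j)%:R}.
Proof.
move=> iA; rewrite /dual; case: classical_sets.xgetP => [mu -> []//|/= nomu].
pose W := famspan lam (A :\ i); pose v := lam i - orthoproj W (lam i).
have vW : {in W, forall u, dot v u = 0} by apply: orthoproj_orth.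
have v0 : v != 0.
  rewrite subr_eq0; apply: contra (lam_notin iA) => /eqP ->.
  exact: orthoproj_mem.
have vv : dot v (lam i) = dot v v.
  by rewrite {3}/v linearBr /= (vW (orthoproj _ _)) ?subr0 // orthoproj_mem.
case: (nomu ((dot v v)^-1 *: v)); split.
  rewrite memvZ // memvB ?mem_famspan //.
  by apply: (subvP (famspanS lam (subsetDl A [set i]))); apply: orthoproj_mem.
move=> j jA; rewrite linearZl_LR /=; have [<-|ij] := eqVneq i j.
  by rewrite vv mulVf // dot_eq0.
rewrite (vW (lam j)) ?mulr0 //; apply: mem_famspan.
by rewrite !inE eq_sym ij.
Qed.

Lemma dual_mem i : i \in A -> dual lam A i \in famspan lam A.
Proof. by case/dual_spec. Qed.

Lemma dual_dot : {in A &, forall i j, dot (dual lam A i) (lam j) = (i == j)%:R}.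
Proof. by move=> i j /dual_spec[_]; apply. Qed.

End Dual.
End FamilyFacts.
End Euclidean.

(* Main.v *)
Require Import Defs.
From HB Require Import structures.
From mathcomp Require Import all_boot all_order all_algebra.
From mathcomp Require Import reals.

Set Implicit Arguments.
Unset Strict Implicit.
Unset Printing Implicit Defensive.

Import Order.TTheory GRing.Theory Num.Theory.
Local Open Scope ring_scope.

(* For [E] a set of indices let [pr E] be the orthogonal projection on the span
   of the [D lam_i], [i \in E], and put
     [a_H(E, i) = lam_i (pr E H)],  [c_H(E, i) = D(lam_i) (H - pr E H)].
   Then [phi] is a product over the blocks [E' :\: E] of conditions on
   [a_H(E', i)] and [c_Lam(E, i)], so that the alternating sum over ordered
   partitions computes an entry of the inverse, in the incidence algebra of the
   subsets of [A], of
     [w(E, E') = \prod_(i in E' :\: E) ([0 < a_H(E', i)] - [0 < c_Lam(E, i)])].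
   The inverse is
     [z(E) = \prod_(i in A :\: E) ([c_H(E, i) <= 0] - [lam_i Lam <= 0])]:
   in [\sum_E' w(E, E') z(E')] the signs attached to [Lam] do not depend on
   [E'], and after expanding the products, Moreau's decomposition of [H] with
   respect to a polyhedral cone (exactly one face [E'] fits) makes the sum equal
   to [\prod_i (1 - [0 < c_Lam(E, i)] - [lam_i Lam <= 0])].  Some factor
   vanishes, because [\sum_i c_Lam(E, i) * lam_i Lam] is a squared norm. *)

(** * Indicators and signs as products over indices *)

Lemma natr_forall_in (R : comPzRingType) (I : finType) (B : {set I}) (b : pred I) :
  [forall i in B, b i]%:R = \prod_(i in B) (b i)%:R :> R.
Proof.
case: forall_inP => [h|/forall_inP].
  by rewrite big1 // => i iB; rewrite h.
rewrite negb_forall_in => /exists_inP[i iB hi].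
by rewrite (bigD1 i) //= (negbTE hi) mul0r.
Qed.

Lemma sign_card (R : pzRingType) (I : finType) (B : {set I}) (b : pred I) :
  (-1) ^+ #|[set i in B | b i]| = \prod_(i in B) (-1) ^+ b i :> R.
Proof.
by rewrite prodrXr -sum1dep_card big_mkcondr.
Qed.

(** * Sums over the faces of a cone *)

Section Complementarity.
Variables (K : realDomainType) (I : finType) (B : {set I}).
Variables a c : {set I} -> I -> K.
Implicit Types (F : {set I}) (t : option bool) (i : I).

(* [Some b] forces the position of [i]: the generator [i] of the cone is then
   made bilateral ([b = true]) or removed ([b = false]). *)
Definition face_cond t F i : bool :=
  match t with
  | Some b => (i \in F) == b
  | None => if i \in F then 0 < a F i else c F i <= 0
  end.

(** Linear complementarity in abstract form: [a F] and [c F] will be instantiated by the coordinates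
    of the projection attached to [F] and of its residue. *)
Hypothesis complementary : forall F1 F2, F1 \subset B -> F2 \subset B ->
  {in F1 :\: F2, forall i, a F1 i * c F2 i <= 0} ->
  {in F2 :\: F1, forall i, a F2 i * c F1 i <= 0} ->
  {in F1 :\: F2, forall i, a F1 i = 0 /\ c F2 i = 0}.

Lemma face_cond_mul_le0 t F1 F2 i :
  face_cond t F1 i -> face_cond t F2 i -> i \in F1 :\: F2 ->
  0 < a F1 i /\ a F1 i * c F2 i <= 0.
Proof.
case: t => [b|] /=; rewrite inE => + + /andP[iF2 iF1].
  by rewrite iF1 (negbTE iF2) => /eqP <-.
by rewrite iF1 (negbTE iF2) => a0 c0; split=> //; rewrite pmulr_rle0.
Qed.

(** A forced index cannot lie in just one of the two faces. At a free index of [F1 :\: F2],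
    [face_cond] makes [a F1 i] positive while [complementary] makes it zero. *)
Lemma face_unique (f : I -> option bool) F1 F2 :
    F1 \subset B -> F2 \subset B ->
    {in B, forall i, face_cond (f i) F1 i} ->
    {in B, forall i, face_cond (f i) F2 i} -> F1 = F2.
Proof.
suff sub (G1 G2 : {set I}) : G1 \subset B -> G2 \subset B ->
    {in B, forall i, face_cond (f i) G1 i} ->
    {in B, forall i, face_cond (f i) G2 i} -> G1 \subset G2.
  by move=> s1 s2 h1 h2; apply/eqP; rewrite eqEsubset; apply/andP; split; apply: sub.
move=> s1 s2 h1 h2; rewrite -setD_eq0; apply/set0Pn => -[i iG].
have iB (H1 H2 : {set I}) j : H1 \subset B -> j \in H1 :\: H2 -> j \in B.
  by move=> /subsetP s; rewrite inE => /andP[_ /s].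
have [||] := complementary s1 s2 _ _ iG.
- by move=> j jG; case: (face_cond_mul_le0 (h1 _ (iB _ _ _ s1 jG))
    (h2 _ (iB _ _ _ s1 jG)) jG).
- by move=> j jG; case: (face_cond_mul_le0 (h2 _ (iB _ _ _ s2 jG))
    (h1 _ (iB _ _ _ s2 jG)) jG).
move=> a0 _; have iB1 := iB _ _ _ s1 iG.
by case: (face_cond_mul_le0 (h1 _ iB1) (h2 _ iB1) iG); rewrite a0 ltxx.
Qed.

(* Force a free index [i0] into the face, then out of it: if neither face
   fits, the two of them contradict [complementary]. *)
Lemma face_exists (f : I -> option bool) :
  exists2 F : {set I}, F \subset B & {in B, forall i, face_cond (f i) F i}.
Proof.
have [n] := ubnP #|[set i in B | f i == None]|.
elim: n f => // n IHn f; rewrite ltnS => fn.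
have [f0|[i0]] := set_0Vmem [set i in B | f i == None].
  exists [set i in B | f i == Some true].
    by apply/subsetP => i; rewrite inE => /andP[].
  move=> i iB; move/setP/(_ i): f0; rewrite !inE iB /=.
  by case Ef: (f i) => [[]|] //= _; rewrite !inE iB Ef.
rewrite inE => /andP[i0B /eqP fi0].
pose g b i := if i == i0 then Some b else f i.
have IHg b : exists2 F : {set I}, F \subset B & {in B, forall i, face_cond (g b i) F i}.
  apply: IHn; apply: leq_trans fn; apply: proper_card; apply/properP; split.
    by apply/subsetP => i; rewrite !inE /g; case: (i == i0); rewrite ?andbF.
  by exists i0; rewrite !inE /g ?fi0 i0B eqxx.
have [F1 s1 h1] := IHg true; have [F2 s2 h2] := IHg false.
have i01 : i0 \in F1 by have := h1 _ i0B; rewrite /g eqxx /= => /eqP.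
have i02 : i0 \notin F2 by have := h2 _ i0B; rewrite /g eqxx /= => /eqP ->.
have gf b i : i != i0 -> g b i = f i by rewrite /g => /negbTE ->.
have [a1|a1] := ltP 0 (a F1 i0).
  exists F1 => // i iB; have [->|ii0] := eqVneq i i0; last by rewrite -(gf true) ?h1.
  by rewrite fi0 /= i01.
have [c2|c2] := leP (c F2 i0) 0.
  exists F2 => // i iB; have [->|ii0] := eqVneq i i0; last by rewrite -(gf false) ?h2.
  by rewrite fi0 /= (negbTE i02).
have h1' i : i != i0 -> i \in B -> face_cond (f i) F1 i.
  by move=> ii0 iB; rewrite -(gf true) ?h1.
have h2' i : i != i0 -> i \in B -> face_cond (f i) F2 i.
  by move=> ii0 iB; rewrite -(gf false) ?h2.
have i0F : i0 \in F1 :\: F2 by rewrite inE i01 i02.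
(* Both candidates fail at [i0], so [a F1 i0 <= 0 < c F2 i0]: the product at [i0] is nonpositive
   too, and [complementary] yields [c F2 i0 = 0]. *)
have [||] := complementary s1 s2 _ _ i0F.
- move=> i iF; have [->|ii0] := eqVneq i i0; first by rewrite pmulr_lle0.
  have iB : i \in B by apply: (subsetP s1); case/setDP: iF.
  by case: (face_cond_mul_le0 (h1' _ ii0 iB) (h2' _ ii0 iB) iF).
- move=> i iF; have ii0 : i != i0 by apply: contraTneq iF => ->; rewrite !inE i01.
  have iB : i \in B by apply: (subsetP s2); case/setDP: iF.
  by case: (face_cond_mul_le0 (h2' _ ii0 iB) (h1' _ ii0 iB) iF).
by move=> _ c0; rewrite c0 ltxx in c2.
Qed.

Lemma sum_face_cond (R : comPzRingType) (f : I -> option bool) :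
  \sum_(F : {set I} | F \subset B) \prod_(i in B) (face_cond (f i) F i)%:R = 1 :> R.
Proof.
have [F0 s0 h0] := face_exists f.
rewrite (bigD1 F0) //= big1 ?add0r; last by move=> i iB; rewrite h0.
rewrite big1 ?addr0 // => F /andP[sF FF0].
have [i iB hi] : exists2 i, i \in B & ~~ face_cond (f i) F i.
  apply/exists_inP; rewrite -negb_forall_in; apply: contra FF0 => /forall_inP hF.
  exact/eqP/(face_unique sF s0 hF).
by rewrite (bigD1 i) //= (negbTE hi) mul0r.
Qed.

(* Both factors are affine in indicator functions; expanding them leaves a sum
   of products of [face_cond]s, each of which sums to 1 over the faces. *)
Lemma sum_face_prod (R : comPzRingType) (x y : I -> R) :
  \sum_(F : {set I} | F \subset B)
    \prod_(i in B) (if i \in F then (0 < a F i)%R%:R - x i else (c F i <= 0)%R%:R - y i)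
  = \prod_(i in B) (1 - x i - y i).
Proof.
(* [k i t] is the coefficient of [face_cond t F i] in the factor at [i]; the three coefficients add
   up to [1 - x i - y i]. *)
pose k i t := match t with
  | None => 1 | Some true => - x i | Some false => - y i end : R.
have sum3 (h : option bool -> R) : \sum_t h t = h None + h (Some true) + h (Some false).
  by rewrite (bigD1 None) //= (bigD1 (Some true)) //= (bigD1 (Some false)) //=
    big1 ?addr0 ?addrA // => -[[]|].
have distr (h : I -> option bool -> R) : \prod_(i in B) \sum_t h i t =
    \sum_(f in pffun_on None (mem B) predT) \prod_(i in B) h i (f i).
  exact: big_distr_big.
have -> : \prod_(i in B) (1 - x i - y i) = \prod_(i in B) \sum_t k i t.
  by apply: eq_bigr => i _; rewrite sum3.
rewrite distr.
transitivity (\sum_(F : {set I} | F \subset B)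
    \prod_(i in B) \sum_t k i t * (face_cond t F i)%:R).
  apply: eq_bigr => F _; apply: eq_bigr => i _; rewrite sum3 /=.
  by case: (i \in F); rewrite /= ?mulr1 ?mulr0 ?mul1r ?addr0.
under eq_bigr do rewrite distr.
rewrite exchange_big; apply: eq_bigr => f _ /=.
under eq_bigr do rewrite big_split /=.
by rewrite -big_distrr /= sum_face_cond mulr1.
Qed.

End Complementarity.

(** * Ordered partitions and sums over chains of subsets *)

Section OrderedPartitions.
Variable I : finType.
Implicit Types (A B E F : {set I}) (p : seq {set I}).

(** Unlike [ordered_partition], this admits the empty sequence (for [set0]), so that removing the
    first block gives a recursion. *)
Definition blocks_partition B p : bool :=
  [&& set0 \notin p,
      pairwise (fun F F' : {set I} => [disjoint F & F']) p &
      \bigcup_(F <- p) F == B].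

Lemma blocks_partition_nil B : blocks_partition B [::] = (B == set0).
Proof. by rewrite /blocks_partition big_nil /= eq_sym. Qed.

Lemma blocks_partition_cons B F p :
  blocks_partition B (F :: p) =
  [&& F != set0, F \subset B & blocks_partition (B :\: F) p].
Proof.
rewrite /blocks_partition inE negb_or /= big_cons eq_sym.
have [//|_ /=] := eqVneq; case: (set0 \notin p); rewrite /= ?andbF //.
case: (pairwise _ p); rewrite /= ?andbF //.
have -> : all (fun F' : {set I} => [disjoint F & F']) p
    = [disjoint F & \bigcup_(F' <- p) F'].
  elim: p => [|G p IHp] /=; first by rewrite big_nil -setI_eq0 setI0 eqxx.
  by rewrite big_cons IHp -!setI_eq0 setIUr setU_eq0.
rewrite andbT.
apply/andP/andP => [[dF /eqP <-]|[sF /eqP ->]].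
  split; first exact: subsetUl.
  rewrite setDUl setDv set0U; apply/eqP/esym/setDidPl.
  by rewrite disjoint_sym.
split; first by rewrite -setI_eq0 setDE setICA setICr setI0.
by rewrite -{1}(setIidPr sF) setID.
Qed.

Lemma blocks_partition_card B p :
  blocks_partition B p -> (\sum_(F <- p) #|F| = #|B|)%N.
Proof.
elim: p B => [|F p IHp] B.
  by rewrite blocks_partition_nil big_nil => /eqP ->; rewrite cards0.
rewrite blocks_partition_cons big_cons => /and3P[_ sF /IHp ->].
by rewrite cardsD (setIidPr sF) subnKC // subset_leq_card.
Qed.

Lemma sum_tuple_cons (R : nmodType) (T : finType) r (Q : pred (seq T)) (G : seq T -> R) :
  \sum_(p : r.+1.-tuple T | Q p) G p =
  \sum_x \sum_(p : r.-tuple T | Q (x :: p)) G (x :: p).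
Proof.
rewrite pair_big_dep /=.
rewrite (reindex (fun xp : T * r.-tuple T => [tuple of xp.1 :: xp.2])) //=.
exists (fun p : r.+1.-tuple T => (thead p, [tuple of behead p])).
  by move=> [x p] _; congr pair; apply: val_inj.
by move=> p _; rewrite [RHS]tuple_eta; apply: val_inj.
Qed.

Lemma sum_tuple0 (R : nmodType) (T : finType) (Q : pred (seq T)) (G : seq T -> R) :
  \sum_(p : 0.-tuple T | Q p) G p = if Q [::] then G [::] else 0.
Proof.
rewrite big_mkcond (big_pred1 [tuple]) //=.
by move=> p; apply/esym/eqP/tuple0.
Qed.

Section ChainSum.
Variables (R : comPzRingType) (A : {set I}).

(** An interval is recorded by its lower end and its increment: [w E F] stands for w(E, E ∪ F). *)
Fixpoint chain_weight (w : {set I} -> {set I} -> R) E p : R :=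
  if p is F :: p' then w E F * chain_weight w (E :|: F) p' else 1.

Variables (w : {set I} -> {set I} -> R) (z : {set I} -> R).
Hypotheses (w0 : forall E, w E set0 = 1) (zA : z A = 1).
Hypothesis wz : forall E, E \proper A ->
  \sum_(F : {set I} | F \subset A :\: E) w E F * z (E :|: F) = 0.

(* The alternating sum of [w] over chains is the inverse of [w] in the
   incidence algebra of the subsets of [A]. *)
Lemma sum_chain_weight n E : E \subset A -> (#|A :\: E| <= n)%N ->
  \sum_(0 <= r < n.+1) \sum_(p : r.-tuple {set I} | blocks_partition (A :\: E) p)
    (-1) ^+ r * chain_weight w E p = z E.
Proof.
elim: n E => [|n IHn] E sE.
  rewrite leqn0 cards_eq0 => /eqP AE.
  rewrite big_nat1 (sum_tuple0 (blocks_partition _) (fun p => _ * chain_weight w E p)).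
  have <- : A = E by apply/eqP; rewrite eqEsubset sE -setD_eq0 AE eqxx.
  by rewrite blocks_partition_nil setDv eqxx mulr1.
(* The term [r = 0] is 1 if [E = A] and 0 otherwise; in the others, the first block is removed and
   joined to [E]. *)
move=> nE; rewrite big_nat_recl //.
rewrite (sum_tuple0 (blocks_partition _) (fun p => _ * chain_weight w E p)).
rewrite blocks_partition_nil /=.
have step r : \sum_(p : r.+1.-tuple {set I} | blocks_partition (A :\: E) p)
      (-1) ^+ r.+1 * chain_weight w E p =
    - \sum_(F : {set I} | (F \subset A :\: E) && (F != set0)) w E F *
      \sum_(p : r.-tuple {set I} | blocks_partition (A :\: (E :|: F)) p)
        (-1) ^+ r * chain_weight w (E :|: F) p.
  rewrite (sum_tuple_cons r (blocks_partition _) (fun p => _ * chain_weight w E p)).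
  rewrite -sumrN [RHS]big_mkcond; apply: eq_bigr => F _.
  under eq_bigl do rewrite blocks_partition_cons setDDl.
  case: (F != set0); last by rewrite andbF big_pred0.
  rewrite andbT; case: (F \subset _); last by rewrite big_pred0.
  rewrite big_distrr -sumrN; apply: eq_bigr => p _ /=.
  by rewrite exprS mulN1r mulNr mulrCA.
under eq_bigr do rewrite step.
rewrite sumrN exchange_big /=.
have tail : \sum_(F : {set I} | (F \subset A :\: E) && (F != set0))
      \sum_(0 <= r < n.+1) w E F *
      \sum_(p : r.-tuple {set I} | blocks_partition (A :\: (E :|: F)) p)
        (-1) ^+ r * chain_weight w (E :|: F) p =
    \sum_(F : {set I} | (F \subset A :\: E) && (F != set0)) w E F * z (E :|: F).
  apply: eq_bigr => F /andP[sF F0]; rewrite -big_distrr /= IHn //.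
    by rewrite subUset sE (subset_trans sF) // subsetDl.
  rewrite -setDDl -ltnS; apply: leq_trans nE.
  by rewrite cardsD (setIidPr sF) ltn_subrL (leq_trans _ (subset_leq_card sF)) card_gt0 F0.
rewrite tail; have [AE|AE] := eqVneq (A :\: E) set0.
  have <- : A = E by apply/eqP; rewrite eqEsubset sE -setD_eq0 AE eqxx.
  rewrite setDv big_pred0 ?subr0 ?mulr1 ?zA //.
  by move=> F; rewrite subset0; case: eqP.
have := @wz E; rewrite properE sE -setD_eq0 AE => /(_ isT).
(* The term [F = set0] of [wz] is [z E], hence [z E] is the opposite of the sum over nonempty
   [F]. *)
rewrite (bigD1 set0) ?sub0set //= w0 mul1r setU0 add0r.
by move/eqP; rewrite addr_eq0 => /eqP ->.
Qed.

End ChainSum.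

(** Each index contributes once, in the block containing it. The base [E] is arbitrary because the
    induction absorbs the first block into it. *)
Lemma chain_weight_prod (R : comPzRingType) (g : {set I} -> {set I} -> I -> R) E B p :
  blocks_partition B p ->
  chain_weight (fun E F => \prod_(i in F) g E (E :|: F) i) E p =
  \prod_(i in B) g (E :|: blocks_upto p (block_of p i).-1)
                   (E :|: blocks_upto p (block_of p i)) i.
Proof.
elim: p E B => [|F p IHp] E B /=.
  by rewrite blocks_partition_nil => /eqP ->; rewrite big_set0.
rewrite blocks_partition_cons => /and3P[_ sF pB].
rewrite (IHp _ _ pB) [RHS](big_setID F) (setIidPr sF) /=.
congr (_ * _); apply: eq_bigr => i.
  move=> iF; rewrite /block_of /= iF /blocks_upto /= take0 big_nil setU0.
  by rewrite big_seq1.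
rewrite inE => /andP[/negbTE iF _].
rewrite /block_of /= iF /blocks_upto /= !big_cons.
by rewrite !setUA.
Qed.

End OrderedPartitions.

(** * Orthogonal projections *)

Section Projections.
Variables (K : realType) (V : vectType K) (dot : {dot V for idfun}).
Implicit Types (U W : {vspace V}) (u v x : V).

Lemma dot_ge0 u : 0 <= dot u u.
Proof.
have [->|u0] := eqVneq u 0; first by rewrite linear0r.
exact/ltW/neq0_dnorm_gt0.
Qed.

Lemma orthoproj_unique U u v :
  u \in U -> {in U, forall x, dot (v - u) x = 0} -> orthoproj dot U v = u.
Proof.
move=> uU vu; apply/eqP; rewrite -subr_eq0 -(dot_eq0 dot).
set x := orthoproj dot U v - u.
have xU : x \in U by rewrite memvB // orthoproj_mem.
have {1}-> : x = (v - u) - (v - orthoproj dot U v).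
  by rewrite opprB [RHS]addrC addrA subrK.
by rewrite linearBl /= vu // orthoproj_orth // subr0 eqxx.
Qed.

Lemma dot_orthoprojC U u v :
  dot (orthoproj dot U u) v = dot u (orthoproj dot U v).
Proof.
have half x y : dot (orthoproj dot U x) y = dot (orthoproj dot U x) (orthoproj dot U y).
  apply/eqP; rewrite -subr_eq0 -linearBr /= dot_sym orthoproj_orth //.
  exact: orthoproj_mem.
by rewrite half [RHS]dot_sym [RHS]half dot_sym.
Qed.

Lemma dot_orthoproj_id U u v : u \in U -> dot u (orthoproj dot U v) = dot u v.
Proof.
move=> uU; apply/eqP; rewrite -subr_eq0 -linearBr /= -opprB linearNr /=.
by rewrite dot_sym orthoproj_orth ?oppr0.
Qed.

Lemma orthoproj_capO U W v : (U <= W)%VS ->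
  orthoproj dot (W :&: orthov dot U) v = orthoproj dot W v - orthoproj dot U v.
Proof.
move=> /subvP sUW; apply: orthoproj_unique.
  apply/memv_capP; split; first by rewrite memvB ?orthoproj_mem ?sUW ?orthoproj_mem.
  apply/mem_orthovP => x xU.
  have -> : orthoproj dot W v - orthoproj dot U v =
      (v - orthoproj dot U v) - (v - orthoproj dot W v).
    by rewrite opprB [RHS]addrC addrA subrK.
  by rewrite linearBl /= !orthoproj_orth ?subrr ?sUW.
move=> x /memv_capP[xW /mem_orthovP xO].
rewrite opprB addrCA linearDl /= orthoproj_orth // addr0 dot_sym.
exact/xO/orthoproj_mem.
Qed.

End Projections.

(** * Coordinates with respect to a family and its dual *)

Section DualFamilies.
Variables (K : realType) (V : vectType K) (dot : {dot V for idfun}).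
Variables (I : finType) (lam : I -> V) (A : {set I}).
Hypothesis lam_notin : {in A, forall i, lam i \notin famspan lam (A :\ i)}.
Implicit Types (E F : {set I}) (u v H Lam : V) (i j : I).

Local Notation D := (dual dot lam A).
Local Notation pr E := (orthoproj dot (famspan D E)).

(** These are a_H(E, i) and c_H(E, i). For [E \subset A] and [i \in E], the first is the coordinate
    of [pr E H] on [D i] and the second is zero. *)
Definition coord_in E H i : K := dot (lam i) (pr E H).
Definition coord_out E H i : K := dot (D i) (H - pr E H).

Lemma dot_dual : {in A &, forall i j, dot (lam i) (D j) = (i == j)%:R}.
Proof. by move=> i j iA jA; rewrite dot_sym dual_dot // eq_sym. Qed.

Lemma famspan_dual_expand E u : E \subset A -> u \in famspan D E ->
  u = \sum_(i in E) dot (lam i) u *: D i.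
Proof.
move=> /subsetP sE; rewrite /famspan span_def big_image /= => /memv_sumP[v vv ->].
apply: eq_bigr => i iE; rewrite linear_sumr (bigD1 i) //= big1 ?addr0; last first.
  move=> j /andP[jE ji]; have /vlineP[k ->] := vv j jE.
  by rewrite linearZr_LR /= dot_dual ?sE // eq_sym (negbTE ji) mulr0.
have /vlineP[k ->] := vv i iE.
by rewrite linearZr_LR /= dot_dual ?sE // eqxx mulr1.
Qed.

Lemma dot_famspan_dual E u i : E \subset A -> u \in famspan D E ->
  i \in A -> i \notin E -> dot (lam i) u = 0.
Proof.
move=> sE uE iA iE; rewrite (famspan_dual_expand sE uE) linear_sumr big1 //.
move=> j jE; rewrite linearZr_LR /= (dot_dual iA (subsetP sE _ jE)).
by rewrite (negbTE (_ : i != j)) ?mulr0 //; apply: contraNneq iE => ->.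
Qed.

Lemma coord_out_mem E H i : i \in E -> coord_out E H i = 0.
Proof. by move=> iE; rewrite /coord_out dot_sym orthoproj_orth // mem_famspan. Qed.

Lemma dot_expand E u v : E \subset A -> u \in famspan D E ->
  dot u v = \sum_(i in E) dot (lam i) u * dot (D i) v.
Proof.
move=> sE uE; rewrite dot_sym {1}(famspan_dual_expand sE uE) linear_sumr.
by apply: eq_bigr => i _; rewrite linearZr_LR /= (dot_sym dot v).
Qed.

Lemma pr_memS E E' H : E \subset E' -> pr E H \in famspan D E'.
Proof. by move=> sE; apply: (subvP (famspanS _ sE)); apply: orthoproj_mem. Qed.

Lemma dot_lam_diff E E' H i : E \subset A -> i \in A -> i \notin E ->
  dot (lam i) (pr E' H - pr E H) = coord_in E' H i.
Proof.
move=> sE iA iE; by rewrite linearBr /= (dot_famspan_dual sE (orthoproj_mem dot _ H)) ?subr0.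
Qed.

(* [pr E1 H - pr E H] and [H - pr E2 H] are dual expansions: the first over
   [E1 :\: E], the second vanishing on [E2]. *)
Lemma dot_diff E E1 E2 H :
  E \subset E1 -> E1 \subset A -> E \subset E2 ->
  dot (pr E1 H - pr E H) (H - pr E2 H) =
  \sum_(i in E1 :\: E2) coord_in E1 H i * coord_out E2 H i.
Proof.
move=> s1 sA s2; rewrite (dot_expand _ sA); last by rewrite memvB ?orthoproj_mem ?pr_memS.
rewrite (big_setID E2) /= big1 ?add0r; last first.
  by move=> i; rewrite inE => /andP[_ iE2]; rewrite -/(coord_out _ _ _) coord_out_mem ?mulr0.
apply: eq_bigr => i; rewrite inE => /andP[iE2 iE1].
rewrite dot_lam_diff ?(subset_trans s1) ?(subsetP sA) //.
by apply: contra iE2; apply: subsetP.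
Qed.

Lemma dot_diff_orth E E1 H : E \subset E1 ->
  dot (pr E1 H - pr E H) (H - pr E1 H) = 0.
Proof. by move=> s1; rewrite dot_sym orthoproj_orth // memvB ?orthoproj_mem ?pr_memS. Qed.

(* With [X = pr E1 H - pr E2 H], the hypotheses give [dot X X <= 0]. *)
Lemma pr_complementary E E1 E2 H :
  E \subset E1 -> E1 \subset A -> E \subset E2 -> E2 \subset A ->
  {in E1 :\: E2, forall i, coord_in E1 H i * coord_out E2 H i <= 0} ->
  {in E2 :\: E1, forall i, coord_in E2 H i * coord_out E1 H i <= 0} ->
  pr E1 H = pr E2 H.
Proof.
move=> s1 sA1 s2 sA2 h12 h21; apply/eqP; rewrite -subr_eq0 -(dot_eq0 dot).
apply/eqP/le_anti; rewrite dot_ge0 andbT.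
(* The left copy of X is split through [pr E H], the right one through [H]; two of the four products
   vanish by [dot_diff_orth]. *)
have -> : dot (pr E1 H - pr E2 H) (pr E1 H - pr E2 H) =
    dot (pr E1 H - pr E H) (H - pr E2 H) + dot (pr E2 H - pr E H) (H - pr E1 H).
  have e12 : pr E1 H - pr E2 H = (pr E1 H - pr E H) - (pr E2 H - pr E H).
    by rewrite opprB addrA subrK.
  have e21 : pr E1 H - pr E2 H = (H - pr E2 H) - (H - pr E1 H).
    by rewrite opprB [RHS]addrC addrA subrK.
  have bilin x1 x2 y1 y2 : dot x1 y1 = 0 -> dot x2 y2 = 0 ->
      dot (x1 - x2) (y2 - y1) = dot x1 y2 + dot x2 y1.
    by move=> z1 z2; rewrite linearBl !linearBr /= z1 z2 subr0 sub0r opprK.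
  by rewrite -bilin ?dot_diff_orth // -e12 -e21.
rewrite !dot_diff // -[leRHS]addr0; apply: lerD; exact: sumr_le0.
Qed.

Lemma pr_eq_coord E1 E2 H i :
  E1 \subset A -> E2 \subset A -> pr E1 H = pr E2 H -> i \in E1 :\: E2 ->
  coord_in E1 H i = 0 /\ coord_out E2 H i = 0.
Proof.
move=> s1 s2 e12; rewrite inE => /andP[i2 i1]; split; last first.
  by rewrite /coord_out -e12 -/(coord_out _ _ _) coord_out_mem.
rewrite /coord_in e12 (dot_famspan_dual s2) ?orthoproj_mem //.
exact: (subsetP s1).
Qed.

(** The dual expansion [v] of [lam i] also lies in the span of [lam], and [lam i - v] is orthogonal
    to that span. *)
Lemma famspan_dual_lam i : i \in A -> lam i \in famspan D A.
Proof.
move=> iA; pose v := \sum_(j in A) dot (lam j) (lam i) *: D j.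
have vD : v \in famspan D A.
  by apply: memv_suml => j jA; rewrite memvZ // mem_famspan.
suff -> : lam i = v by [].
have vlam : v \in famspan lam A.
  by apply: memv_suml => j jA; rewrite memvZ // dual_mem.
apply/eqP; rewrite -subr_eq0 -(dot_eq0 dot).
have: lam i - v \in famspan lam A by rewrite memvB // mem_famspan.
have lamv j : j \in A -> dot (lam j) (lam i - v) = 0.
  move=> jA; rewrite linearBr /= [X in _ - X]linear_sumr (bigD1 j) //= big1.
    by rewrite linearZr_LR /= dot_dual // eqxx mulr1 addr0 subrr.
  move=> k /andP[kA kj]; rewrite linearZr_LR /= dot_dual //.
  by rewrite eq_sym (negbTE kj) mulr0.
rewrite {1}/famspan span_def big_image /= => /memv_sumP[u uu e].
rewrite [X in dot _ X]e linear_sumr big1 // => j jA.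
by have /vlineP[k ->] := uu j jA; rewrite linearZr_LR /= dot_sym lamv ?mulr0.
Qed.

Lemma coord_in_full H i : i \in A -> coord_in A H i = dot (lam i) H.
Proof. by move=> iA; rewrite /coord_in dot_orthoproj_id // famspan_dual_lam. Qed.

(* The products [dot (lam i) Lam * coord_out E Lam i] sum to the square of the
   norm of [pr A Lam - pr E Lam]. *)
Lemma exists_same_sign E Lam : E \proper A ->
  exists2 i, i \in A :\: E & (0 < coord_out E Lam i) = (0 < dot (lam i) Lam).
Proof.
move=> /properP[sE [i0 i0A i0E]].
suff /exists_inP[i iAE /eqP e] : [exists i in A :\: E,
    (0 < coord_out E Lam i) == (0 < dot (lam i) Lam)] by exists i.
apply/contraT; rewrite negb_exists_in => /forall_inP h.
have eA i : i \in A :\: E -> coord_in A Lam i = dot (lam i) Lam.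
  by case/setDP => iA _; apply: coord_in_full.
(* If the signs differ everywhere, all products are nonpositive and complementarity applies to [A]
   and [E]. *)
have AE : pr A Lam = pr E Lam.
  apply: (pr_complementary (E := E)) => // i; last first.
    by rewrite inE => /andP[iA iE]; rewrite (subsetP sE) in iA.
  move=> iAE; rewrite eA //; move: (h i iAE).
  case: ltP => c0; case: ltP => l0 //= _; first by rewrite pmulr_lle0.
  by rewrite pmulr_rle0.
have i0AE : i0 \in A :\: E by rewrite inE i0E.
have [] := pr_eq_coord (subxx A) sE AE i0AE.
(* Both numbers vanish at [i0], so the two sign tests agree there after all. *)
by move=> a0 c0; move: (h i0 i0AE); rewrite -eA // a0 c0 eqxx.
Qed.

Lemma coord_complementary E H F1 F2 :
  E \subset A -> F1 \subset A :\: E -> F2 \subset A :\: E ->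
  {in F1 :\: F2, forall i, coord_in (E :|: F1) H i * coord_out (E :|: F2) H i <= 0} ->
  {in F2 :\: F1, forall i, coord_in (E :|: F2) H i * coord_out (E :|: F1) H i <= 0} ->
  {in F1 :\: F2, forall i, coord_in (E :|: F1) H i = 0 /\ coord_out (E :|: F2) H i = 0}.
Proof.
move=> sE s1 s2 h12 h21 i iF.
have sA F : F \subset A :\: E -> E :|: F \subset A.
  by move=> sF; rewrite subUset sE (subset_trans sF) // subsetDl.
have toD G1 G2 j : j \in (E :|: G1) :\: (E :|: G2) -> j \in G1 :\: G2.
  by rewrite !inE; case: (j \in E).
have e12 : pr (E :|: F1) H = pr (E :|: F2) H.
  apply: (pr_complementary (E := E)); rewrite ?subsetUl ?sA // => j /toD.
    exact: h12.
  exact: h21.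
apply: (pr_eq_coord _ _ e12); rewrite ?sA //.
move: iF (subsetP s1 i); rewrite !inE => /andP[/negbTE -> iF1] /(_ iF1) /andP[/negbTE -> _].
by rewrite iF1.
Qed.

(** This is -[a_H <= 0] if c_Lam > 0 and [0 < a_H] otherwise: the condition in [phi] at [i] with its
    sign, times -1 for the share of [i] in the block sizes. *)
Definition chain_factor Lam H E E' i : int :=
  (0 < coord_in E' H i)%R%:R - (0 < coord_out E Lam i)%R%:R.

(** For [E = set0] this is the signed condition at [i] in [theta_hat]. *)
Definition dual_factor Lam H E i : int :=
  (coord_out E H i <= 0)%R%:R - (dot (lam i) Lam <= 0)%R%:R.

Lemma sum_chain_dual_factor Lam H E : E \proper A ->
  \sum_(F : {set I} | F \subset A :\: E)
    (\prod_(i in F) chain_factor Lam H E (E :|: F) i) *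
    (\prod_(i in A :\: (E :|: F)) dual_factor Lam H (E :|: F) i) = 0.
Proof.
move=> pE; have sE := proper_sub pE.
pose a F := coord_in (E :|: F) H; pose c F := coord_out (E :|: F) H.
transitivity (\sum_(F : {set I} | F \subset A :\: E) \prod_(i in A :\: E)
    (if i \in F then (0 < a F i)%R%:R - (0 < coord_out E Lam i)%R%:R
     else (c F i <= 0)%R%:R - (dot (lam i) Lam <= 0)%R%:R) : int).
  apply: eq_bigr => F sF; rewrite [RHS](big_setID F) (setIidPr sF) /= setDDl.
  congr (_ * _); apply: eq_bigr => i; first by move=> ->.
  by rewrite !inE negb_or => /andP[/andP[_ /negbTE ->]].
rewrite (sum_face_prod (a := a) (c := c)); last first.
  by move=> F1 F2 s1 s2; apply: coord_complementary.
have [i iAE e] := exists_same_sign Lam pE.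
rewrite (bigD1 i) //= e.
by case: (ltP 0 (dot (lam i) Lam)) => _; rewrite /= ?subr0 subrr mul0r.
Qed.

(** * Projections of the two families on the spaces of the blocks *)

Section Parts.
Variables (p : seq {set I}).
Hypothesis pA : \bigcup_(F <- p) F = A.

Lemma blocks_upto_sub k : blocks_upto p k \subset A.
Proof.
rewrite -pA -{2}(cat_take_drop k p) big_cat; exact: subsetUl.
Qed.

Lemma blocks_uptoS k : blocks_upto p k \subset blocks_upto p k.+1.
Proof.
have [kp|pk] := ltnP k (size p).
  by rewrite /blocks_upto (take_nth set0) // -cats1 big_cat subsetUl.
by rewrite /blocks_upto !take_oversize // leqW.
Qed.

Lemma block_ofP i : i \in A ->
  i \in blocks_upto p (block_of p i) :\: blocks_upto p (block_of p i).-1.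
Proof.
rewrite -pA /block_of /blocks_upto /=; elim: p => [|F q IHq] /=.
  by rewrite big_nil inE.
rewrite big_cons inE; case: (boolP (i \in F)) => /= [iF _|iF /IHq].
  by rewrite take0 big_seq1 big_nil !inE iF.
by rewrite !big_cons !inE (negbTE iF).
Qed.

(** Projecting on [Wspace] subtracts two nested projections, and [lam i] vanishes on the smaller
    space since [i] is in no earlier block. *)
Lemma dot_lam_part i H : i \in A ->
  dot (lam_part dot lam A p i) H = coord_in (blocks_upto p (block_of p i)) H i.
Proof.
move=> iA; have /setDP[_ iE] := block_ofP iA.
rewrite /lam_part /Wspace /Uspace orthoproj_capO; last exact/famspanS/blocks_uptoS.
rewrite linearBl /= !dot_orthoprojC -linearBr /=.
by rewrite dot_lam_diff ?blocks_upto_sub.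
Qed.

(** Here the larger projection has no effect, since [D i] lies in its image. *)
Lemma dot_mu_part i H : i \in A ->
  dot (mu_part dot lam A p i) H = coord_out (blocks_upto p (block_of p i).-1) H i.
Proof.
move=> iA; have /setDP[iE _] := block_ofP iA.
rewrite /mu_part /Wspace /Uspace orthoproj_capO; last exact/famspanS/blocks_uptoS.
rewrite linearBl /= !dot_orthoprojC /coord_out linearBr /=.
by rewrite dot_orthoproj_id // mem_famspan.
Qed.

End Parts.

(** * Both sides of the identity as products, and the conclusion *)

Lemma theta_hat_prod Lam H :
  (-1) ^+ b_hat dot lam A Lam * (theta_hat dot lam A Lam H)%:R =
  \prod_(i in A) dual_factor Lam H set0 i.
Proof.
rewrite /b_hat /theta_hat sign_card natr_forall_in -big_split /=.
have pr0 : pr set0 H = 0.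
  have -> : famspan D set0 = 0%VS by rewrite /famspan span_def big_image big_set0.
  by apply/eqP; rewrite -memv0 orthoproj_mem.
apply: eq_bigr => i iA; rewrite /dual_factor /coord_out pr0 subr0.
by case: (ltP 0 (dot (lam i) Lam)) => _; case: (ltP 0 (dot (D i) H)).
Qed.

Lemma phi_prod Lam H r (p : r.-tuple {set I}) : blocks_partition A p ->
  (-1) ^+ alpha dot lam A p Lam * (phi dot lam A p Lam H)%:R =
  (-1) ^+ r * chain_weight
    (fun E F => \prod_(i in F) chain_factor Lam H E (E :|: F) i) set0 p.
Proof.
move=> pP; have /and3P[_ _ /eqP pA] := pP.
rewrite (chain_weight_prod _ _ pP) /alpha /b_part /phi.
(* The sum over blocks is [#|A| + r]: [r] gives the sign of the chain sum, and [#|A|] a factor -1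
   for each index. *)
rewrite big_split /= sum1_size size_tuple (blocks_partition_card pP).
rewrite addnA exprD -mulrA mulrCA; congr (_ * _).
rewrite exprD sign_card natr_forall_in -prodr_const -!big_split /=.
apply: eq_bigr => i iA; rewrite /chain_factor !set0U dot_mu_part // dot_lam_part //.
by case: (ltP 0 (coord_out _ Lam i)) => _; case: (ltP 0 (coord_in _ H i)).
Qed.

Lemma sum_phi Lam H : A != set0 ->
  \sum_(1 <= r < #|A|.+1)
    \sum_(p : r.-tuple {set I} | ordered_partition A p)
      (-1) ^+ alpha dot lam A p Lam * (phi dot lam A p Lam H)%:R
  = (-1) ^+ b_hat dot lam A Lam * (theta_hat dot lam A Lam H)%:R :> int.
Proof.
move=> A0.
pose w E F := \prod_(i in F) chain_factor Lam H E (E :|: F) i.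
pose z E := \prod_(i in A :\: E) dual_factor Lam H E i.
have -> : (-1) ^+ b_hat dot lam A Lam * (theta_hat dot lam A Lam H)%:R = z set0 :> int.
  by rewrite theta_hat_prod /z setD0.
have w0 E : w E set0 = 1 by rewrite /w big_set0.
have zA : z A = 1 by rewrite /z setDv big_set0.
have nA : (#|A :\: set0| <= #|A|)%N by rewrite setD0.
rewrite -(sum_chain_weight w0 zA (sum_chain_dual_factor Lam H) (sub0set A) nA).
(* The chain sum starts at [r = 0]; that term vanishes because the empty sequence does not partition
   the nonempty [A]. *)
rewrite setD0 [RHS]big_ltn //.
rewrite (sum_tuple0 (blocks_partition _) (fun p => _ * chain_weight w set0 p)).
rewrite blocks_partition_nil (negbTE A0) add0r.
apply: eq_big_nat => r /andP[r0 _]; apply: eq_big => p.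
  by rewrite /ordered_partition size_tuple r0.
by rewrite /ordered_partition size_tuple r0; apply: phi_prod.
Qed.

End DualFamilies.

Theorem proposition4p1 (K : realType) (V0 : vectType K)
    (dot : {dot V0 for idfun}) (n : nat) (Delta0 : n.-tuple V0)
    (hDelta0 : basis_of fullv Delta0)
    (P R : {set 'I_n}) (hPR : P \proper R) (Lam : V0) :
  let A := R :\: P in
  let Delta := projfam dot (tnth Delta0) P in
  forall H : V0,
    \sum_(1 <= r < #|A|.+1)
      \sum_(p : r.-tuple {set 'I_n} | ordered_partition A p)
        (-1) ^+ alpha dot Delta A p Lam * (phi dot Delta A p Lam H)%:R
    = (-1) ^+ b_hat dot Delta A Lam * (theta_hat dot Delta A Lam H)%:R :> int.
Proof.
move=> A Delta H; apply: sum_phi.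
  by apply: projfam_notin => i; apply: basis_notin; apply: basis_free hDelta0.
by rewrite setD_eq0; case/andP: hPR.
Qed.
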